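(* Let $(U_\alpha)_{\alpha\in\omega^\omega}$ be an $\omega^\omega$-base for a topological space $X$, and for $\beta\in\omega^{<\omega}$ put $U_\beta=\bigcap\{U_\alpha:\alpha\in\omega^\omega,\ \alpha\text{ extends }\beta\}\subset X\times X$. Then the pair $\big(\{U_\beta\}_{\beta\in\omega^{<\omega}},\{U_\alpha\}_{\alpha\in\omega^\omega}\big)$ is a countable $\mathsf{s}^*$-netbase for $X$. If the space $X$ is countably tight, then this pair is a countable $\mathsf{p}^*$-netbase for $X$.
   Context: $\omega^\omega$ carries the coordinatewise order; $\omega^{<\omega}=\bigcup_{n}\omega^n$; $\alpha\in\omega^\omega$ extends $\beta\in\omega^n$ if $\alpha|n=\beta$. An entourage on $X$ is a subset $E\subset X\times X$ containing the diagonal; $E[x]=\{y:(x,y)\in E\}$. An entourage base for a topological space $X$ is a family $\mathcal B$ of entourages such that (i) for all $B_1,B_2\in\mathcal B$ there is $B_3\in\mathcal B$ with $B_3\subset B_1\cap B_2$; (ii) for every $x\in X$ the family $\{B[x]:B\in\mathcal B\}$ is a neighborhood base at $x$ (neighborhoods need not be open). An $\omega^\omega$-base for $X$ is a family $(U_\alpha)_{\alpha\in\omega^\omega}$ of entourages on $X$ such that $U_\beta\subset U_\alpha$ whenever $\alpha\le\beta$, and for every $x\in X$ the family $\{U_\alpha[x]\}_{\alpha\in\omega^\omega}$ is a neighborhood base at $x$. A set $C\subset X$ accumulates at $x$ if every neighborhood of $x$ contains infinitely many points of $C$. For a family $\mathcal C$ of subsets of $X$, a family $\mathcal N$ of subsets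 of $X$ is a $\mathcal C^*$-network at $x$ if for any neighborhood $O_x$ of $x$ and any $C\in\mathcal C$ accumulating at $x$ there is $N\in\mathcal N$ with $x\in N\subset O_x$ and $N\cap C$ infinite. A $\mathcal C^*$-netbase for $X$ is a pair $(\mathcal N,\mathcal B)$ where $\mathcal N$ is a family of entourages on $X$ and $\mathcal B$ is an entourage base for $X$ such that for every $B\in\mathcal B$ and $x\in X$ the family $\{N[x]:N\in\mathcal N,\ N\subset B\}$ is a $\mathcal C^*$-network at $x$. It is countable if $\mathcal N$ is countable. Here $\mathsf{s}$ denotes the family of all countable subsets of $X$ and $\mathsf{p}$ the family of all subsets of $X$. $X$ is countably tight if for every $A\subset X$ and $x\in\overline A$ there is a countable $B\subset A$ with $x\in\overline B$. *)

(* Defs.v *)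
From mathcomp Require Import all_boot all_order.
From mathcomp Require Import all_classical.
From mathcomp Require Import topology.
Set Implicit Arguments.
Unset Strict Implicit.
Unset Printing Implicit Defensive.
Local Open Scope classical_set_scope.

(* The ball E[x] = {y : (x, y) \in E} is the library's [xsection E x]. These
   entourages carry no uniform structure: they only contain the diagonal. *)
Definition is_entourage (X : Type) (E : set (X * X)) : Prop := diagonal `<=` E.

Definition nbhs_base_at (X : topologicalType) (x : X) (F : set (set X)) : Prop :=
  F `<=` nbhs x /\ forall O, nbhs x O -> exists2 A, F A & A `<=` O.

Definition entourage_base (X : topologicalType) (B : set (set (X * X))) : Prop :=
  [/\ (forall E, B E -> is_entourage E),
      (forall B1 B2, B B1 -> B B2 -> exists2 B3, B B3 & B3 `<=` B1 `&` B2) &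
      (forall x : X, nbhs_base_at x [set xsection E x | E in B])].

Definition omega_omega_base (X : topologicalType)
    (U : (nat -> nat) -> set (X * X)) : Prop :=
  [/\ (forall a, is_entourage (U a)),
      (forall a b, (forall n, a n <= b n) -> U b `<=` U a) &
      (forall x : X, nbhs_base_at x [set xsection (U a) x | a in setT])].

Definition clusters_infinitely_at (X : topologicalType) (C : set X) (x : X) : Prop :=
  forall O, nbhs x O -> infinite_set (O `&` C).

Definition star_network_at (X : topologicalType) (CC : set (set X))
    (NN : set (set X)) (x : X) : Prop :=
  forall (O C : set X), nbhs x O -> CC C -> clusters_infinitely_at C x ->
  exists N, [/\ NN N, N x, N `<=` O & infinite_set (N `&` C)].

Definition star_netbase (X : topologicalType) (CC : set (set X))
    (NN BB : set (set (X * X))) : Prop :=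
  [/\ (forall N, NN N -> is_entourage N),
      entourage_base BB &
      (forall (B : set (X * X)) (x : X), BB B ->
         star_network_at CC
           [set xsection N x | N in [set N | NN N /\ N `<=` B]] x)].

Definition countable_star_netbase (X : topologicalType) (CC : set (set X))
    (NN BB : set (set (X * X))) : Prop :=
  star_netbase CC NN BB /\ countable NN.

Definition countable_subsets (X : Type) : set (set X) := [set C | countable C].

Definition all_subsets (X : Type) : set (set X) := setT.

Arguments countable_subsets X : clear implicits.
Arguments all_subsets X : clear implicits.

Definition countably_tight (X : topologicalType) : Prop :=
  forall (A : set X) (x : X), closure A x ->
  exists B : set X, [/\ B `<=` A, countable B & closure B x].

(* A finite sequence b of length n is encoded as an element of [seq nat];
   [mkseq a n] is the restriction of a to n = {0, ..., n - 1}. *)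
Definition extends (a : nat -> nat) (b : seq nat) : Prop :=
  mkseq a (size b) = b.

Definition stem_entourage (X : Type) (U : (nat -> nat) -> set (X * X))
    (b : seq nat) : set (X * X) :=
  \bigcap_(a in [set a | extends a b]) U a.

(* Main.v *)
Require Import Defs.
From mathcomp Require Import all_boot all_order.
From mathcomp Require Import all_classical.
From mathcomp Require Import topology.
Local Open Scope classical_set_scope.

(** Write [a|n] for the stem [mkseq a n].  Everything rests on one fact: if a
    countable set [C] accumulates at [x], then for every [a] some ball
    [U_(a|n)[x]] meets [C] in an infinite set ([infinite_stem_ball]).
    Given a neighborhood [O] of [x]
    and a member [U a] of the base, one picks [d >= a] with [U_d[x]] inside [O];
    then [U_(d|n)] lies in [U d], hence in [U a], and the fact applied to [d]
    yields the network element.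

    The fact is a diagonal argument.  Suppose that [U_(a|n)[x]] meets [C] in a
    finite set for every [n].  Each [c] in [C] outside [U_(a|0)[x]] is excluded
    from [U_b[x]] for some [b], and [b] can be chosen to agree with [a] as long
    as [c] stays outside [U_(a|n)[x]] and [n] does not exceed the rank of [c] in
    an enumeration of [C] ([late_witness]).  At each coordinate only finitely
    many of these witnesses then differ from [a], so they have a common pointwise
    bound [g] ([pointwise_bound]).  By monotonicity [U_g[x]] misses all of these
    [c], hence it meets [C] in a finite set, although it is a neighborhood
    of [x].

    Countable tightness replaces an arbitrary accumulating set by a countable
    accumulating subset ([countably_tight_accumulation]).  As [X] need not satisfy
    any separation axiom, the points of [C] that lie in every neighborhood of [x]
    need a separate treatment: if there are infinitely many of them, countably
    many suffice; otherwise they can be discarded, and a countable set of the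
    remaining points that has [x] in its closure accumulates at [x]. *)

Lemma finite_bound {T : choiceType} {A : set T} (f : T -> nat) :
  finite_set A -> exists m, forall x, A x -> f x <= m.
Proof.
move=> /finite_fsetP[F ->]; exists (\max_(x <- finmap.enum_fset F) f x) => x xF.
exact: (@leq_bigmax_seq _ _ xpredT f).
Qed.

Lemma pointwise_bound {T : choiceType} (D : set T) (a : nat -> nat)
    (b : T -> nat -> nat) :
  (forall i, finite_set [set c | D c /\ a i < b c i]) ->
  exists g : nat -> nat, forall c, D c -> forall i, b c i <= g i.
Proof.
move=> fin; have /choice[m mP] i := finite_bound (fun c => b c i) (fin i).
exists (fun i => maxn (a i) (m i)) => c Dc i; rewrite leq_max.
by case: (leqP (b c i) (a i)) => //= lt_ab; apply: mP.
Qed.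

Lemma extends_mkseq (a b : nat -> nat) n :
  extends b (mkseq a n) -> forall i, i < n -> b i = a i.
Proof.
rewrite /extends size_mkseq => eq_ba i lt_in.
by rewrite -(nth_mkseq 0 b lt_in) eq_ba nth_mkseq.
Qed.

Lemma stem_sub {X : Type} (U : (nat -> nat) -> set (X * X)) a n :
  stem_entourage U (mkseq a n) `<=` U a.
Proof. by move=> p; apply; rewrite /= /extends size_mkseq. Qed.

(** The witness [b] may have to leave [a] at the first coordinate [i] such that
    [p] enters [U_(a|i+1)], since no extension of [a|i+1] then excludes [p].  If
    [p] never enters, the witnesses for different [r] can differ, and the rank [r]
    tells how long the chosen one agrees with [a]. *)
Lemma late_witness {X : Type} (U : (nat -> nat) -> set (X * X))
    (a : nat -> nat) (p : X * X) (r : nat) :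
  ~ stem_entourage U [::] p ->
  exists b, ~ U b p /\
    forall i, i < r -> b i <> a i -> stem_entourage U (mkseq a i.+1) p.
Proof.
move=> p0; have outside n : ~ stem_entourage U (mkseq a n) p ->
    exists b, ~ U b p /\ forall i, i < n -> b i = a i.
  move=> /existsNP[b] /not_implyP[eb nUb].
  by exists b; split => //; apply: extends_mkseq.
elim: r => [|r [b [nUb IHb]]].
  by have [b [nUb _]] := outside 0 p0; exists b; split.
have [inr|/outside[b' [nUb' eqb']]] := pselect (stem_entourage U (mkseq a r.+1) p).
  exists b; split => // i; rewrite ltnS leq_eqVlt => /orP[/eqP->//|].
  exact: IHb.
by exists b'; split => // i /eqb' ->.
Qed.

Section OmegaBase.
Context {X : topologicalType} {U : (nat -> nat) -> set (X * X)}.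
Hypothesis hU : omega_omega_base U.

Lemma nbhs_omega_ball a x : nbhs x (xsection (U a) x).
Proof. by case: hU => _ _ /(_ x)[+ _]; apply; exists a. Qed.

Lemma omega_ball_sub {x : X} {O : set X} :
  nbhs x O -> exists a, xsection (U a) x `<=` O.
Proof. by case: hU => _ _ /(_ x)[_ +] => /[apply] -[_ [a _ <-]]; exists a. Qed.

Lemma omega_base_maxn a b :
  U (fun n => maxn (a n) (b n)) `<=` U a `&` U b.
Proof.
case: hU => _ mono _ p pU; split; apply: mono pU => n.
- exact: leq_maxl.
- exact: leq_maxr.
Qed.

Lemma omega_entourage_base : entourage_base (range U).
Proof.
case: (hU) => diagU _ baseU; split.
- by move=> _ [a _ <-]; apply: diagU.
- move=> _ _ [a _ <-] [b _ <-].
  exists (U (fun n => maxn (a n) (b n))); first by exists (fun n => maxn (a n) (b n)).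
  exact: omega_base_maxn.
- by move=> x; rewrite image_comp; apply: baseU.
Qed.

(** The diagonal argument: [D] consists of the points that have a witness, and
    the witness of [c] exceeds [a] at [i] only if [c] has rank at most [i] or lies
    in [U_(a|i+1)[x]], which leaves finitely many [c] for each [i]. *)
Lemma infinite_stem_ball {C : set X} {x : X} (a : nat -> nat) :
  countable C -> clusters_infinitely_at C x ->
  exists n, infinite_set (xsection (stem_entourage U (mkseq a n)) x `&` C).
Proof.
move=> /countable_injP[r r_inj] Cx; apply: contrapT => /forallNP.
move=> fin; have {fin}finF n :
    finite_set (xsection (stem_entourage U (mkseq a n)) x `&` C).
  exact: contrapT (fin n).
pose D := C `\` xsection (stem_entourage U [::]) x.
have /choice[b bP] c : exists b, D c -> ~ U b (x, c) /\
    forall i, i < r c -> b i <> a i -> stem_entourage U (mkseq a i.+1) (x, c).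
  have [[_ nc]|nDc] := pselect (D c); last by exists a.
  have [|b bP] := @late_witness _ U a (x, c) (r c); last by exists b.
  by move=> ?; apply: nc; apply/xsectionP.
have [i|g gP] := @pointwise_bound X D a b.
  have finr : finite_set (C `&` [set c | r c <= i]).
    have inj_r : {in C `&` [set c | r c <= i] &, injective r}.
      by move=> c d; rewrite !in_setI => /andP[? _] /andP[? _]; apply: r_inj.
    rewrite -(eq_finite_set (inj_card_eq inj_r)).
    by apply: sub_finite_set (finite_II i.+1) => _ [c [_ le_ri] <-].
  apply: sub_finite_set (_ : _ `<=` (C `&` [set c | r c <= i]) `|` _) _; last first.
    by rewrite finite_setU; split; [exact: finr | exact: (finF i.+1)].
  move=> c [Dc lt_ab]; have [Cc _] := Dc; have [_ late] := bP c Dc.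
  have [le_ri|lt_ir] := leqP (r c) i; [by left | right; split => //].
  apply/xsectionP/late => // eq_ba; by rewrite eq_ba ltnn in lt_ab.
apply: (Cx _ (nbhs_omega_ball g x)); apply: sub_finite_set (finF 0).
move=> c [/xsectionP Ugc Cc]; split => //; apply: contrapT => nc.
have Dc : D c by [].
have [nUb _] := bP c Dc; apply: nUb.
by case: hU => _ mono _; apply: mono Ugc; apply: gP.
Qed.

End OmegaBase.

Lemma countably_tight_accumulation {X : topologicalType} {C : set X} {x : X} :
  countably_tight X -> clusters_infinitely_at C x ->
  exists D, [/\ D `<=` C, countable D & clusters_infinitely_at D x].
Proof.
move=> tightX Cx; pose K := [set y | forall O, nbhs x O -> O y].
have [finCK|/infiniteP/card_subP[D cardD subD]] := pselect (finite_set (C `&` K)).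
  have [|D [DCK countD xD]] := tightX (C `\` K) x.
    move=> O xO; have [y [[Oy Cy] nCKy]] :=
      infinite_setN0 (infinite_setD (Cx O xO) finCK).
    by exists y; split => //; split => // Ky; apply: nCKy.
  exists D; split => //; first by move=> y /DCK[].
  move=> O xO finOD.
  have /choice[V VP] y : exists V, nbhs x V /\ (D y -> ~ V y).
    have [/DCK[_ /existsNP[V /not_implyP[xV nVy]]]|nDy] := pselect (D y).
      by exists V.
    by exists setT; split => //; apply: filterT.
  (* Shrinking [O] away from its finitely many points of [D] contradicts the
     choice of [D]. *)
  have xV : nbhs x (\bigcap_(y in O `&` D) V y).
    case/finite_fsetP: finOD => F ->; apply: filter_bigI => y _.
    by have [] := VP y.
  have [y [Dy [Oy Vy]]] := xD _ (filterI xO xV).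
  by have [_ /(_ Dy)] := VP y; apply; apply: Vy.
exists D; split.
- by move=> y /subD[].
- by move: cardD; rewrite card_eq_le => /andP[].
- move=> O xO; apply: (@sub_infinite_set _ D).
    by move=> y Dy; split => //; have [_] := subD y Dy; apply.
  by apply/infiniteP; move: cardD; rewrite card_eq_le => /andP[].
Qed.

Lemma countably_tight_star_netbase {X : topologicalType}
    (NN BB : set (set (X * X))) :
  countably_tight X -> star_netbase (countable_subsets X) NN BB ->
  star_netbase (all_subsets X) NN BB.
Proof.
move=> tightX [entN baseB netN]; split => // B x BB_B O C xO _ Cx.
have [D [DC countD Dx]] := countably_tight_accumulation tightX Cx.
have [N [NN_N Nx NO infND]] := netN B x BB_B _ _ xO countD Dx.
exists N; split => //; apply: sub_infinite_set infND; exact: setIS.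
Qed.

Lemma omega_base_star_netbase {X : topologicalType}
    {U : (nat -> nat) -> set (X * X)} :
  omega_omega_base U ->
  star_netbase (countable_subsets X) (range (stem_entourage U)) (range U).
Proof.
move=> hU; case: (hU) => diagU _ _.
have diag_stem s : is_entourage (stem_entourage U s).
  by move=> p pdiag a _; apply: diagU.
split; [by move=> _ [s _ <-] | exact: omega_entourage_base |].
move=> _ x [a _ <-] O C xO countC Cx.
have [b bO] := omega_ball_sub hU xO.
pose d n := maxn (a n) (b n).
have dab : U d `<=` U a `&` U b := omega_base_maxn hU a b.
have [n infn] := infinite_stem_ball hU d countC Cx.
have stem_d := @stem_sub X U d n.
exists (xsection (stem_entourage U (mkseq d n)) x); split => //.
- by exists (stem_entourage U (mkseq d n)) => //; split => // p /stem_d /dab[].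
- exact/xsectionP/diag_stem.
- by move=> y /xsectionP /stem_d /dab[_ Uby]; apply/bO/xsectionP.
Qed.

Theorem theorem4p2 (X : topologicalType) (U : (nat -> nat) -> set (X * X))
    (hU : omega_omega_base U) :
  countable_star_netbase (countable_subsets X)
    (range (stem_entourage U)) (range U) /\
  (countably_tight X ->
   countable_star_netbase (all_subsets X)
     (range (stem_entourage U)) (range U)).
Proof.
have countN : countable (range (stem_entourage U)).
  by apply: sub_countable (card_image_le _ _) _; apply: countableP.
have netU := omega_base_star_netbase hU.
by split=> [|tightX]; split => //; apply: countably_tight_star_netbase.
Qed.
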